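(* Consider the two-stage stochastic linear program and the inexact regularized L-shaped algorithm described in the context, with descent parameter $\beta\in(0,1)$. Suppose: (i) $X$ is non-empty and bounded with diameter $D$, i.e. $\|x-\bar x\|\le D$ for all $x,\bar x\in X$; (ii) there are $\epsilon_1,\epsilon_2$ such that for every outer iteration $k$ and all $x\in X$, $\hat f_k(x)\in[f(x)-\epsilon_1,f(x)+\epsilon_2]$; (iii) there is $G>0$ such that $\|\hat g_k(x)\|\le G$ for every outer iteration $k$ and all $x\in X$; (iv) for all $k\ge 0$ and $0\le t\le T_k-2$, the bundle function $f_{k,t+1}:\mathbb{R}^n\to\mathbb{R}$ is convex, $G$-Lipschitz continuous, and for all $x\in\mathbb{R}^n$ $$\hat f_k(x)\ge f_{k,t+1}(x)\ge\max\{\hat f_k(x_{k,t+1})+\hat g_k(x_{k,t+1})^T(x-x_{k,t+1}),\ f_{k,t}(x_{k,t+1})+s_{k,t+1}^T(x-x_{k,t+1})\},$$ where $s_{k,t+1}=\rho_k(x_{k,0}-x_{k,t+1})$. Let $\bar\epsilon=(\beta+1)(\epsilon_1+\epsilon_2)$, assumed to lie in $(0,1)$. Suppose the algorithm uses a constant step-size $\rho_k=\rho>0$ for all $k\ge0$. Define $$\delta^C:=\max\left\{\frac{4\bar\epsilon}{\beta},\sqrt{\frac{4\bar\epsilon\rho}{\beta}}\,D\right\},\qquad K^C:=\max\left\{0,\left\lceil\frac{f(x_{0,0})-f^*-\delta^C}{\bar\epsilon}\right\rceil\right\}.$$ Then there exists an outer iteration $k\le K^C$ such that $f(x_{k,0})-f^*\le\delta^C$.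 Furthermore, the total number of inner steps (including null steps) before such a solution is found is at most $$\left(\left\lceil\frac{8G^2}{\rho(1-\beta)^2\bar\epsilon}-\frac{16}{(1-\beta)^2}\right\rceil+1\right)K^C.$$
   Context: Problem. $\min_{x\in X} f(x):=c^Tx+\mathbb{E}_\xi[Q(x;\xi)]$ with $X=\{x\in\mathbb{R}^n: Ax=b,\ x\ge0\}$ and $Q(x;\xi)=\min_{y\in\mathbb{R}^l}\{q(\xi)^Ty: T(\xi)x+Wy=h(\xi),\ y\ge0\}$, where $A\in\mathbb{R}^{m\times n}$, $b\in\mathbb{R}^m$, $c\in\mathbb{R}^n$, $W\in\mathbb{R}^{r\times l}$ (not depending on $\xi$) and $(T(\xi),q(\xi),h(\xi))\in\mathbb{R}^{r\times n}\times\mathbb{R}^l\times\mathbb{R}^r$. The function $f:X\to\mathbb{R}$ is real-valued and convex, and $f^*=\min_{x\in X}f(x)$. $\|\cdot\|$ is the Euclidean norm. Estimates. For $x\in X$, $U(x;\xi)$ denotes a chosen element of $\arg\max_{u\in\mathbb{R}^r}\{u^T(h(\xi)-T(\xi)x): W^Tu\le q(\xi)\}$. Given a finite set $S_k$ of samples $\xi_i$ of $\xi$, $$\hat f_k(x)=c^Tx+\frac1{|S_k|}\sum_{i\in S_k}Q(x;\xi_i),\qquad \hat g_k(x)=c-\frac1{|S_k|}\sum_{i\in S_k}T(\xi_i)^TU(x;\xi_i)\in\partial\hat f_k(x).$$ Algorithm (inexact regularized L-shaped algorithm). Input: $x_{0,0}\in X$, step-sizes $\rho_k>0$, $\beta\in(0,1)$.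 For each outer iteration $k=0,1,2,\dots$: draw a sample set $S_k$, form $\hat f_k,\hat g_k$, and set $f_{k,0}(x)=\hat f_k(x_{k,0})+\hat g_k(x_{k,0})^T(x-x_{k,0})$. For each inner iteration $t=0,1,2,\dots$: compute $x_{k,t+1}=\arg\min_{x\in X}\{f_{k,t}(x)+\frac{\rho_k}{2}\|x-x_{k,0}\|^2\}$. If $$\beta(\hat f_k(x_{k,0})-f_{k,t}(x_{k,t+1}))\le\hat f_k(x_{k,0})-\hat f_k(x_{k,t+1}),$$ then (serious step) set $T_k=t+1$, $x_{k+1,0}=x_{k,t+1}$, and go to outer iteration $k+1$. Otherwise (null step) form a new bundle function $$f_{k,t+1}(x)=\max\Big\{\max_{j\in J^g_{k,t+1}}\{\hat f_k(x_{k,j})+\hat g_k(x_{k,j})^T(x-x_{k,j})\},\ \max_{j\in J^s_{k,t+1}}\{f_{k,j-1}(x_{k,j})+s_{k,j}^T(x-x_{k,j})\}\Big\},$$ with index sets $J^g_{k,t+1}\subseteq\{0,\dots,t+1\}$, $J^s_{k,t+1}\subseteq\{1,\dots,t+1\}$ and $s_{k,j}=\rho_k(x_{k,0}-x_{k,j})$, and continue with $t+1$. ($T_k=\infty$ if the inner loop never terminates.) Counting. An inner step is one inner iteration (the computation of one point $x_{k,t+1}$). If $k$ is the first outer iteration for which $x_{k,0}$ has the required accuracy, the number of inner steps before such a solution is found is $\sum_{j<k}T_j$. *)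

(* Defs.v *)
From mathcomp Require Export all_boot all_order all_algebra.
From mathcomp Require Export all_classical all_reals all_analysis.

Set Implicit Arguments.
Unset Strict Implicit.
Unset Printing Implicit Defensive.

Import Order.TTheory GRing.Theory Num.Theory.
Import numFieldNormedType.Exports.

Local Open Scope classical_set_scope.
Local Open Scope ring_scope.

Section Vectors.
Context {R : realType}.

Definition dot n (u v : 'cV[R]_n) : R := \sum_i u i 0 * v i 0.

(* The library norm on ['cV[R]_n] is the sup norm, hence this definition. *)
Definition enorm n (u : 'cV[R]_n) : R := Num.sqrt (dot u u).

Definition vle n (u v : 'cV[R]_n) : Prop := forall i, u i 0 <= v i 0.

Definition elipschitz n (k : R) (phi : 'cV[R]_n -> R) : Prop :=
  forall x y, `|phi x - phi y| <= k * enorm (x - y).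

Definition argmin (E : Type) (X : set E) (phi : E -> R) : set E :=
  [set x | X x /\ forall y, X y -> phi x <= phi y].

Definition argmax (E : Type) (X : set E) (phi : E -> R) : set E :=
  [set x | X x /\ forall y, X y -> phi y <= phi x].

Definition is_minimum (E : Type) (X : set E) (phi : E -> R) (v : R) : Prop :=
  exists2 x, argmin X phi x & phi x = v.

End Vectors.

(* Data of a two-stage stochastic linear program with [n] first-stage and [l]
   second-stage variables; [Xi] is the space of values of the random element,
   and the recourse matrix [recW] does not depend on it. *)
Record slp (R : realType) (m n r l : nat) (Xi : Type) := Slp {
  matA : 'M[R]_(m, n);
  vecb : 'cV[R]_m;
  vecc : 'cV[R]_n;
  recW : 'M[R]_(r, l);
  techT : Xi -> 'M[R]_(r, n);
  vecq : Xi -> 'cV[R]_l;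
  vech : Xi -> 'cV[R]_r
}.

Section StochasticProgram.
Context {R : realType} {m n r l : nat} {Xi : Type}.
Variable p : slp R m n r l Xi.

Definition feasible : set 'cV[R]_n :=
  [set x | matA p *m x = vecb p /\ vle 0 x].

Definition recourse_set (x : 'cV[R]_n) (s : Xi) : set 'cV[R]_l :=
  [set y | techT p s *m x + recW p *m y = vech p s /\ vle 0 y].

(* [Q(x; xi)], with the usual conventions: [+oo] if the second-stage problem is
   infeasible, [-oo] if it is unbounded. *)
Definition recourse (x : 'cV[R]_n) (s : Xi) : \bar R :=
  ereal_inf [set (dot (vecq p s) y)%:E | y in recourse_set x s].

Definition dual_set (s : Xi) : set 'cV[R]_r :=
  [set u | vle ((recW p)^T *m u) (vecq p s)].

Definition dual_solutions (x : 'cV[R]_n) (s : Xi) : set 'cV[R]_r :=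
  argmax (dual_set s) (fun u => dot u (vech p s - techT p s *m x)).

Definition objective d (Omega : measurableType d) (P : probability Omega R)
    (xi : Omega -> Xi) (x : 'cV[R]_n) : \bar R :=
  ((dot (vecc p) x)%:E + \int[P]_w recourse x (xi w))%E.

Definition fhat (S : seq Xi) (x : 'cV[R]_n) : \bar R :=
  ((dot (vecc p) x)%:E
   + ((size S)%:R^-1)%:E * \sum_(s <- S) recourse x s)%E.

Definition ghat (U : 'cV[R]_n -> Xi -> 'cV[R]_r) (S : seq Xi)
    (x : 'cV[R]_n) : 'cV[R]_n :=
  vecc p - (size S)%:R^-1 *: \sum_(s <- S) (techT p s)^T *m U x s.

End StochasticProgram.

(* Everything produced by one execution. Values at indices which the execution
   does not reach are irrelevant. [inner k] is [T_k], where [None] stands for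
   [T_k = oo]; [iterate k t] is [x_{k,t}] and [model k t] is [f_{k,t}]. *)
Record execution (R : realType) (n : nat) (Xi : Type) := Execution {
  samples : nat -> seq Xi;
  iterate : nat -> nat -> 'cV[R]_n;
  model : nat -> nat -> 'cV[R]_n -> R;
  Jg : nat -> nat -> seq nat;
  Js : nat -> nat -> seq nat;
  inner : nat -> option nat
}.

Section Algorithm.
Context {R : realType} {m n r l : nat} {Xi : Type}.
Variable p : slp R m n r l Xi.
Variable U : 'cV[R]_n -> Xi -> 'cV[R]_r.
Variable beta : R.
Variable rho : nat -> R.
Variable e : execution R n Xi.

(* [t < T_k] *)
Definition before (t : nat) (T : option nat) : bool :=
  if T is Some N then (t < N)%N else true.

(* Outer iteration [k] takes place iff all earlier inner loops terminate. *)
Definition reached (k : nat) : Prop := forall j, (j < k)%N -> inner e j != None.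

Definition fhatk (k : nat) : 'cV[R]_n -> \bar R := fhat p (samples e k).
Definition ghatk (k : nat) : 'cV[R]_n -> 'cV[R]_n := ghat p U (samples e k).

(* [fine] only meets points of [X], where [fhatk k] is finite as soon as it
   approximates the real-valued objective. *)
Definition cut (k j : nat) (x : 'cV[R]_n) : R :=
  fine (fhatk k (iterate e k j)) + dot (ghatk k (iterate e k j)) (x - iterate e k j).

Definition sgrad (k j : nat) : 'cV[R]_n :=
  rho k *: (iterate e k 0 - iterate e k j).

(* [aggcut k t] is the affine function built from [f_{k,t}] and
   [s_{k,t+1}] at [x_{k,t+1}]. *)
Definition aggcut (k t : nat) (x : 'cV[R]_n) : R :=
  model e k t (iterate e k t.+1) + dot (sgrad k t.+1) (x - iterate e k t.+1).

Definition serious (k t : nat) : Prop :=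
  beta * (fine (fhatk k (iterate e k 0)) - model e k t (iterate e k t.+1))
  <= fine (fhatk k (iterate e k 0)) - fine (fhatk k (iterate e k t.+1)).

(* The maxima are taken in [\bar R], where the empty maximum is [-oo]; since
   the result is a real number, the two index sets are not both empty. *)
Definition bundle_update (k t : nat) : Prop :=
  [/\ {subset Jg e k t.+1 <= iota 0 t.+2},
      {subset Js e k t.+1 <= iota 1 t.+1} &
      forall x, (model e k t.+1 x)%:E =
        maxe (\big[maxe/-oo%E]_(j <- Jg e k t.+1) (cut k j x)%:E)
             (\big[maxe/-oo%E]_(j <- Js e k t.+1) (aggcut k j.-1 x)%:E)].

(* One outer iteration. The fourth clause says that [T_k] is [t + 1] for the
   first [t] giving a serious step, and infinite if there is no such [t]. *)
Definition outer_iteration (k : nat) : Prop :=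
  [/\ (0 < size (samples e k))%N,
      forall x, model e k 0 x = cut k 0 x,
      forall t, before t (inner e k) ->
        argmin (feasible p)
          (fun x => model e k t x + rho k / 2 * enorm (x - iterate e k 0) ^+ 2)
          (iterate e k t.+1),
      inner e k <> Some 0%N /\
      (forall t, before t (inner e k) ->
         (serious k t <-> inner e k = Some t.+1)) &
      (forall t, before t.+1 (inner e k) -> bundle_update k t) /\
      (forall N, inner e k = Some N -> iterate e k.+1 0 = iterate e k N)].

Definition is_execution : Prop :=
  feasible p (iterate e 0 0) /\ forall k, reached k -> outer_iteration k.

Definition inner_steps (k : nat) : nat :=
  \sum_(j < k) odflt 0%N (inner e j).

End Algorithm.

(* Main.v *)
(* Let [g_t] be [fhat_k(x_{k,0}) - min_X (f_{k,t} + rho/2 |. - x_{k,0}|^2)]. The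
   Lipschitz bound gives [g_0 <= G^2 / (2 rho)], and a null step forces
   [g_{t+1} <= g_t - kappa g_t^2] with [kappa = (1 - beta)^2 rho / (8 G^2)], so
   [1 / g_t >= kappa (t + 16 / (1 - beta)^2)].
   As long as [x_{k,0}] is not [deltaC]-optimal, convexity of [f] keeps [g_t]
   above [2 epsbar / beta - (eps1 + eps2) >= epsbar]. The bound on [t] this
   yields limits the inner steps, and a serious step then decreases [f] by at
   least [epsbar], which limits the outer iterations.
   That the initial cut [f_{k,0}] minorizes [fhat_k] is strong linear programming
   duality, obtained from Farkas' lemma. *)
Require Import Defs.
From mathcomp Require Import ring lra zify.

Set Implicit Arguments.
Unset Strict Implicit.
Unset Printing Implicit Defensive.

Import Order.TTheory GRing.Theory Num.Theory.
Import numFieldNormedType.Exports.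

Local Open Scope classical_set_scope.
Local Open Scope ring_scope.

(** * Euclidean inner product and norm *)

Section Dot.
Context {R : realType}.

Lemma dotC n (u v : 'cV[R]_n) : dot u v = dot v u.
Proof. by apply: eq_bigr => i _; rewrite mulrC. Qed.

Lemma dotDl n (u v w : 'cV[R]_n) : dot (u + v) w = dot u w + dot v w.
Proof. by rewrite -big_split; apply: eq_bigr => i _; rewrite !mxE mulrDl. Qed.

Lemma dotZl n (a : R) (u v : 'cV[R]_n) : dot (a *: u) v = a * dot u v.
Proof. by rewrite mulr_sumr; apply: eq_bigr => i _; rewrite !mxE mulrA. Qed.

Lemma dotNl n (u v : 'cV[R]_n) : dot (- u) v = - dot u v.
Proof. by rewrite -scaleN1r dotZl mulN1r. Qed.

Lemma dotBl n (u v w : 'cV[R]_n) : dot (u - v) w = dot u w - dot v w.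
Proof. by rewrite dotDl dotNl. Qed.

Lemma dotZr n (a : R) (u v : 'cV[R]_n) : dot u (a *: v) = a * dot u v.
Proof. by rewrite !(dotC u) dotZl. Qed.

Lemma dotBr n (u v w : 'cV[R]_n) : dot u (v - w) = dot u v - dot u w.
Proof. by rewrite !(dotC u) dotBl. Qed.

Lemma dot0l n (u : 'cV[R]_n) : dot 0 u = 0.
Proof. by rewrite -[0](scale0r u) dotZl mul0r. Qed.

Lemma dot_suml n (I : Type) (s : seq I) (F : I -> 'cV[R]_n) v :
  dot (\sum_(i <- s) F i) v = \sum_(i <- s) dot (F i) v.
Proof.
by elim/big_rec2: _ => [|i a b _ <-]; rewrite ?dot0l ?dotDl.
Qed.

Lemma dot_trmx n m (A : 'M[R]_(m, n)) u v : dot (A^T *m u) v = dot u (A *m v).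
Proof.
transitivity (\sum_i \sum_j A j i * u j 0 * v i 0).
  apply: eq_bigr => i _; rewrite mxE mulr_suml.
  by apply: eq_bigr => j _; rewrite mxE.
rewrite exchange_big; apply: eq_bigr => j _; rewrite mxE mulr_sumr.
by apply: eq_bigr => i _; rewrite mulrA (mulrC (u j 0)).
Qed.

Lemma dot_ge0 n (u : 'cV[R]_n) : 0 <= dot u u.
Proof. by apply: sumr_ge0 => i _; rewrite -expr2 sqr_ge0. Qed.

Lemma dot_gt0 n (u : 'cV[R]_n) : u != 0 -> 0 < dot u u.
Proof.
apply: contraNT; rewrite -leNgt => u_le0; apply/eqP/matrixP => i j.
have /eqP : dot u u = 0 by apply/eqP; rewrite eq_le u_le0 dot_ge0.
rewrite psumr_eq0 => [/allP/(_ i (mem_index_enum i))|k _]; last first.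
  by rewrite -expr2 sqr_ge0.
by rewrite ord1 mxE -expr2 sqrf_eq0 => /eqP.
Qed.

Lemma enorm_ge0 n (u : 'cV[R]_n) : 0 <= enorm u.
Proof. exact: sqrtr_ge0. Qed.

Lemma enorm_sqr n (u : 'cV[R]_n) : enorm u ^+ 2 = dot u u.
Proof. by rewrite sqr_sqrtr ?dot_ge0. Qed.

Lemma enormZ n (a : R) (u : 'cV[R]_n) : enorm (a *: u) = `|a| * enorm u.
Proof.
by rewrite /enorm dotZl dotZr mulrA -expr2 sqrtrM ?sqr_ge0// sqrtr_sqr.
Qed.

Lemma enormN n (u : 'cV[R]_n) : enorm (- u) = enorm u.
Proof. by rewrite -scaleN1r enormZ normrN1 mul1r. Qed.

Lemma enorm_gt0 n (u : 'cV[R]_n) : u != 0 -> 0 < enorm u.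
Proof. by move=> /dot_gt0; rewrite sqrtr_gt0. Qed.

Lemma dot_le_enorm n (u v : 'cV[R]_n) : dot u v <= enorm u * enorm v.
Proof.
have [->|/enorm_gt0 u0] := eqVneq u 0.
  by rewrite dot0l mulr_ge0 ?enorm_ge0.
have [->|/enorm_gt0 v0] := eqVneq v 0.
  by rewrite dotC dot0l mulr_ge0 ?enorm_ge0.
have := dot_ge0 (enorm v *: u - enorm u *: v).
rewrite dotBl !dotBr !dotZl !dotZr (dotC v u) -!enorm_sqr => H.
rewrite -subr_ge0 -(pmulr_rge0 _ (mulr_gt0 u0 v0)).
rewrite -(pmulr_rge0 _ (ltr0n R 2)); apply: le_trans H _; lra.
Qed.

Lemma dot_ge_enorm n (u v : 'cV[R]_n) : - (enorm u * enorm v) <= dot u v.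
Proof. by rewrite lerNl -dotNl -(enormN u) dot_le_enorm. Qed.

End Dot.

(** * Farkas' lemma for finitely generated cones *)

Section Farkas.
Context {R : realType}.

(* Given a vector [v] separating [b] from the cone of the tail but not from
   [a i], project everything along [a i] onto the hyperplane orthogonal to [v]
   and apply the induction hypothesis there. *)
Lemma farkas n (I : eqType) (s : seq I) (a : I -> 'cV[R]_n) (b : 'cV[R]_n) :
  uniq s ->
  (exists2 y : I -> R, (forall i, 0 <= y i) & b = \sum_(i <- s) y i *: a i) \/
  (exists2 v, (forall i, i \in s -> dot v (a i) <= 0) & 0 < dot v b).
Proof.
elim: s a b => [|i s IHs] a b /=.
  move=> _; have [->|b0] := eqVneq b 0; last by right; exists b; rewrite ?dot_gt0.
  by left; exists (fun=> 0); rewrite ?big_nil.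
move=> /andP[si us].
have extend (y : I -> R) c : 0 <= c -> (forall j, 0 <= y j) ->
    b = c *: a i + \sum_(j <- s) y j *: a j ->
    exists2 y : I -> R, (forall i, 0 <= y i) &
      b = \sum_(j <- i :: s) y j *: a j.
  move=> c0 y0 ->; exists (fun j => if j == i then c else y j) => [j|].
    by case: ifP.
  rewrite big_cons eqxx; congr (_ + _); apply: eq_big_seq => j js.
  by case: eqP => // ji; rewrite -ji js in si.
have [[y y0 yb]|[v vs vb]] := IHs a b us.
  by left; apply: (extend y 0); rewrite ?scale0r ?add0r.
have [via|via] := leP (dot v (a i)) 0.
  right; exists v => // j; rewrite inE => /predU1P[->//|]; exact: vs.
pose proj w := w - (dot v w / dot v (a i)) *: a i.
have [[y y0 yb]|[w ws wb]] := IHs (proj \o a) (proj b) us.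
  left; apply: (extend y (dot v b / dot v (a i)
      - \sum_(j <- s) y j * (dot v (a j) / dot v (a i)))) => //.
    rewrite subr_ge0; apply: (@le_trans _ _ 0); last first.
      by rewrite divr_ge0// ltW.
    rewrite big_seq; apply: sumr_le0 => j js; rewrite mulr_ge0_le0//.
    by rewrite mulr_le0_ge0 ?vs// invr_ge0 ltW.
  have {1}-> : b = proj b + (dot v b / dot v (a i)) *: a i by rewrite subrK.
  rewrite yb.
  under eq_bigr => j _ do rewrite scalerBr scalerA.
  by rewrite sumrB -scaler_suml scalerBl addrC addrA addrAC.
(* [w - c *: v] is the adjoint of [proj] applied to [w]; it annihilates [a i] because [proj]
   does. *)
pose c := dot w (a i) / dot v (a i).
have projE x : dot (w - c *: v) x = dot w (proj x).
  by rewrite dotBl dotBr dotZl dotZr /c; field; rewrite gt_eqF.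
right; exists (w - c *: v); last by rewrite projE.
move=> j; rewrite inE projE => /predU1P[->|/ws//].
by rewrite /proj divff ?gt_eqF// scale1r subrr dotC dot0l.
Qed.

End Farkas.

(** * Duality for the second-stage linear program *)

Section Duality.
Context {R : realType} {m n r l : nat} {Xi : Type}.
Variable p : slp R m n r l Xi.

Lemma mulmx_sum_scale a b (A : 'M[R]_(a, b)) y :
  A *m y = \sum_i y i 0 *: col i A.
Proof.
apply/matrixP => i j; rewrite mxE summxE; apply: eq_bigr => k _.
by rewrite !mxE ord1 mulrC.
Qed.

Lemma trmx_mul_coord a b (A : 'M[R]_(a, b)) u i : (A^T *m u) i 0 = dot u (col i A).
Proof. by rewrite mxE; apply: eq_bigr => k _; rewrite !mxE mulrC. Qed.

(** Each feasible [y] gives [u^T (h - T x) = (W^T u)^T y <= q^T y], as [y >= 0]; with no such [y]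
    the infimum is [+oo]. *)
Lemma recourse_weak x s u : dual_set p s u ->
  ((dot u (vech p s - techT p s *m x))%:E <= recourse p x s)%E.
Proof.
move=> du; apply: le_ereal_inf_tmp => _ [y [<- y0] <-].
rewrite lee_fin addrAC subrr add0r -dot_trmx.
by apply: ler_sum => i _; rewrite ler_wpM2r//; have := y0 i; rewrite mxE.
Qed.

(* At a dual optimum [u] the objective lies in the cone of the constraints
   active at [u], for otherwise Farkas' lemma gives an ascent direction. *)
Lemma recourse_strong x s u : dual_solutions p x s u ->
  recourse p x s = (dot u (vech p s - techT p s *m x))%:E.
Proof.
move=> [du u_max]; apply/eqP; rewrite eq_le recourse_weak// andbT.
set b := vech p s - _; pose W := recW p; pose q := vecq p s.
pose slack i := q i 0 - dot u (col i W).
have slack_ge0 i : 0 <= slack i.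
  by rewrite subr_ge0 -trmx_mul_coord; exact: du.
pose act := [seq i <- index_enum 'I_l | slack i == 0].
have act_uniq : uniq act by rewrite filter_uniq// index_enum_uniq.
have [[y y0 yb]|[v v_le0 v_gt0]] := farkas (fun i => col i W) b act_uniq.
  (* The Farkas multipliers, extended by zero off the active constraints, satisfy complementary
     slackness with [u], so the primal and dual values agree. *)
  pose z : 'cV[R]_l := \col_i (if slack i == 0 then y i else 0).
  have Wz : W *m z = b.
    rewrite mulmx_sum_scale yb big_filter [RHS]big_mkcond; apply: eq_bigr => i _.
    by rewrite mxE; case: ifP => // _; rewrite scale0r.
  apply: ereal_inf_lbound; exists z.
    split; first by rewrite [_ *m z]Wz addrC subrK.
    by move=> i; rewrite !mxE; case: ifP.
  congr EFin; rewrite -Wz -dot_trmx; apply: eq_bigr => i _.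
  rewrite !mxE; case: ifP => [/eqP|]; last by rewrite !mulr0.
  by move=> /subr0_eq; rewrite -trmx_mul_coord mxE => ->.
exfalso.
(* [M^-1] is a step along [v] short enough to keep the inactive constraints: [M] dominates every
   ratio in the sum, and the summand 1 keeps it positive when the sum is empty. *)
pose M := 1 + \sum_(i | slack i != 0) `|dot v (col i W)| / slack i.
have term_ge0 i : slack i != 0 -> 0 <= `|dot v (col i W)| / slack i.
  by move=> _; rewrite divr_ge0.
have M_gt0 : 0 < M by rewrite ltr_wpDr// sumr_ge0.
have : dual_set p s (u + M^-1 *: v).
  move=> i; rewrite trmx_mul_coord dotDl dotZl -lerBrDl -/(slack i).
  have [s0|s0] := eqVneq (slack i) 0.
    rewrite s0 pmulr_rle0 ?invr_gt0// v_le0// mem_filter s0 eqxx.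
    by rewrite mem_index_enum.
  have si : 0 < slack i by rewrite lt_def s0 slack_ge0.
  rewrite mulrC ler_pdivrMr// -ler_pdivrMl// mulrC.
  apply: (@le_trans _ _ (`|dot v (col i W)| / slack i)).
    by rewrite ler_pM2r ?invr_gt0// ler_norm.
  rewrite /M (bigD1 i)//= addrCA lerDl addr_ge0// sumr_ge0// => j /andP[? _].
  exact: term_ge0.
move=> /u_max; rewrite -/b dotDl dotZl gerDl leNgt => /negP; apply.
by rewrite mulr_gt0 ?invr_gt0.
Qed.

End Duality.

(** * The sample average function and its subgradients *)

Section EmpiricalObjective.
Context {R : realType} {m n r l : nat} {Xi : eqType}.
Variable p : slp R m n r l Xi.

Lemma fhatE (S : seq Xi) (u : Xi -> 'cV[R]_r) x :
  (forall s, s \in S -> dual_solutions p x s (u s)) ->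
  fhat p S x = (dot (vecc p) x + (size S)%:R^-1 *
    \sum_(s <- S) dot (u s) (vech p s - techT p s *m x))%:E.
Proof.
move=> uS; rewrite /fhat EFinD EFinM; congr (_ + _ * _)%E.
by rewrite -sumEFin; apply: eq_big_seq => s sS; rewrite (recourse_strong (uS s sS)).
Qed.

(** The dual feasible set does not depend on the first-stage point, so [U x s] competes in the dual
    problem at [y], where [U y s] is optimal; average over the samples. *)
Lemma ghat_subgradient (S : seq Xi) U x y :
  (forall s, s \in S -> dual_solutions p x s (U x s)) ->
  (forall s, s \in S -> dual_solutions p y s (U y s)) ->
  fine (fhat p S x) + dot (ghat p U S x) (y - x) <= fine (fhat p S y).
Proof.
move=> Ux Uy; rewrite (fhatE Ux) (fhatE Uy) /= /ghat.
rewrite dotBl dotZl dot_suml dotBr.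
set c := dot _ x; set N := _^-1; set a := \sum_(_ <- _) _; set b := \sum_(_ <- _) _.
set a' := \sum_(_ <- _) _.
have : N * (a - b) <= N * a'.
  rewrite ler_wpM2l ?invr_ge0// /a /b /a' -sumrB big_seq [leRHS]big_seq.
  apply: ler_sum => s sS; rewrite dot_trmx -dotBr mulmxBr.
  rewrite opprB addrA subrK; have [+ _] := Ux s sS.
  by have [_] := Uy s sS; apply.
lra.
Qed.

End EmpiricalObjective.

(** * Scalar recursions and convexity along segments *)

Lemma reciprocal_growth (R : realFieldType) (v : nat -> R) (kappa c eps : R) N :
  0 < kappa -> 0 <= c -> 0 < eps -> kappa * c * v 0%N <= 1 ->
  (forall t, (t <= N)%N -> eps <= v t) ->
  (forall t, (t < N)%N -> v t.+1 <= v t - kappa * v t ^+ 2) ->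
  N%:R <= (kappa * eps)^-1 - c.
Proof.
move=> k0 c0 e0 v0 v_ge v_rec.
(* This is [1 / v N >= kappa (N + c)] without division. With [a = kappa v N] and
   [b = kappa (N + c) v N], the inductive step [(a + b) (1 - a) <= 1] amounts to
   [(1 - a) (1 - b) + a ^ 2 >= 0]; positivity of [v N.+1] gives [a < 1]. *)
have : kappa * (N%:R + c) * v N <= 1.
  elim: N v_ge v_rec => [_ _|N IHN v_ge v_rec]; first by rewrite add0r.
  have {}IHN := IHN (fun t tN => v_ge t (leqW tN)) (fun t tN => v_rec t (leqW tN)).
  have vN1 := v_rec N (ltnSn N).
  have vN : 0 < v N by rewrite (lt_le_trans e0)// v_ge.
  have u1 : kappa * v N < 1.
    rewrite -subr_gt0 -(pmulr_rgt0 _ vN); have := v_ge N.+1 (leqnn _); lra.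
  have a0 : 0 <= kappa * (N.+1%:R + c) by rewrite mulr_ge0 ?(ltW k0)// addr_ge0.
  apply: le_trans (ler_wpM2l a0 vN1) _.
  have := sqr_ge0 (kappa * v N).
  have : 0 <= (1 - kappa * v N) * (1 - kappa * (N%:R + c) * v N).
    by rewrite mulr_ge0// ?subr_ge0// ltW.
  rewrite -natr1; lra.
have Nc : 0 <= kappa * (N%:R + c) by rewrite mulr_ge0 ?(ltW k0)// addr_ge0.
move=> /(le_trans (ler_wpM2l Nc (v_ge N (leqnn N)))) H.
rewrite lerBrDr -[_^-1]mul1r ler_pdivlMr ?mulr_gt0//; lra.
Qed.

Lemma descent_sum (R : realDomainType) (v : nat -> R) (eps : R) k :
  (forall j, (j < k)%N -> v j.+1 <= v j - eps) -> v k <= v 0%N - k%:R * eps.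
Proof.
elim: k => [_|k IHk H]; first by rewrite mul0r subr0.
have := H k (ltnSn k); have := IHk (fun j jk => H j (leqW jk)).
rewrite -natr1; lra.
Qed.

Lemma convex_function_segment (R : realType) (E : lmodType R) (X : set E)
    (f : E -> R) x y (s : R) : convex_function X f ->
  X x -> X y -> 0 <= s <= 1 -> f (x + s *: (y - x)) <= f x + s * (f y - f x).
Proof.
move=> f_convex Xx Xy /andP[s0 s1].
have := f_convex (Itv01 s0 s1) y x (mem_set Xy) (mem_set Xx).
rewrite convRE /= /unstable.onem => H.
have -> : x + s *: (y - x) = s *: y + (1 - s) *: x.
  by rewrite scalerBr scalerBl scale1r [RHS]addrCA.
by apply: le_trans H _; lra.
Qed.


(** * Proximal bundle steps with a fixed centre *)

Section BundleMethod.
Context {R : realType} {n : nat}.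
Variables (X : set 'cV[R]_n) (rho G beta : R).
Hypotheses (rho_gt0 : 0 < rho) (G_gt0 : 0 < G) (beta_gt0 : 0 < beta).

Definition segment_closed := forall x y s, X x -> X y -> 0 <= s <= 1 ->
  X (x + s *: (y - x)).

Definition prox (M : 'cV[R]_n -> R) (c x : 'cV[R]_n) :=
  M x + rho / 2 * enorm (x - c) ^+ 2.

(** Moving from [z] towards [c] by a fraction [s] raises [M] by at most [s G |c - z|]; if [z] were
    too far from [c], the fall of the proximal term would outweigh this. *)
Lemma prox_step_bound M c z : segment_closed -> elipschitz G M ->
  X c -> argmin X (prox M c) z -> rho * enorm (c - z) <= G.
Proof.
move=> Xseg ML Xc [Xz zmin]; rewrite leNgt; apply/negP => G_lt.
set N := enorm (c - z) in G_lt *.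
have N_gt0 : 0 < N by rewrite -(pmulr_rgt0 _ rho_gt0) (lt_trans G_gt0).
have rN : 0 < rho * N by rewrite mulr_gt0.
(* With this [s = 1 - G / (rho N)], the factor [rho N (2 - s) - 2 G] obtained below equals
   [rho N - G > 0], a contradiction. *)
pose s := (rho * N - G) / (rho * N).
have s_gt0 : 0 < s by rewrite divr_gt0// subr_gt0.
have s_le1 : s <= 1 by rewrite ler_pdivrMr// mul1r gerBl ltW.
have sE : s * (rho * N) = rho * N - G by rewrite divfK ?gt_eqF.
have := zmin _ (Xseg z c s Xz Xc _); rewrite s_le1 ltW// => /(_ isT).
rewrite /prox -[enorm (z - c)]enormN opprB -/N.
have -> : z + s *: (c - z) - c = (s - 1) *: (c - z).
  by rewrite scalerBl scale1r opprB [RHS]addrC addrAC.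
rewrite enormZ exprMn real_normK ?num_real// -/N.
have := ML (z + s *: (c - z)) z.
rewrite addrAC subrr add0r enormZ (ger0_norm (ltW s_gt0)) -/N => /ler_normlP[_].
set Mz := M z; set Mp := M _ => H1 H2.
have : s * N * (rho * N * (2 - s) - 2 * G) <= 0 by lra.
rewrite (pmulr_rle0 _ (mulr_gt0 s_gt0 N_gt0)); lra.
Qed.

(** When [z] minimizes [prox M c] over [X], this is the quantity [g_t] of the introductory sketch;
    in the lemmas below [g] denotes subgradients instead. *)
Definition gap (phi M : 'cV[R]_n -> R) c z := phi c - prox M c z.

Lemma gap_ge phi M c z x : argmin X (prox M c) z -> X x ->
  M x <= phi x -> phi c - phi x - rho / 2 * enorm (x - c) ^+ 2 <= gap phi M c z.
Proof. by move=> [_ zmin] /zmin; rewrite /gap /prox; lra. Qed.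

Lemma gap_affine_le phi M c z g : enorm g <= G ->
  M z = phi c + dot g (z - c) -> gap phi M c z <= G ^+ 2 / (2 * rho).
Proof.
move=> gG Mz; rewrite /gap /prox Mz.
have := dot_ge_enorm g (z - c); have := enorm_ge0 (z - c).
move: (enorm _) (dot _ _) (enorm _) gG => N gd Ng gG N0 H.
have := ler_wpM2r N0 gG => H2.
have : 0 <= (rho * N - G) ^+ 2 / (2 * rho).
  by rewrite divr_ge0 ?sqr_ge0// mulr_ge0// ltW.
have -> : (rho * N - G) ^+ 2 / (2 * rho) =
  rho / 2 * N ^+ 2 - G * N + G ^+ 2 / (2 * rho) by field; rewrite gt_eqF.
lra.
Qed.

(* The new model dominates every convex combination of the new cut and of the
   aggregate cut. The latter plus the proximal term is
   [prox M c z + rho / 2 |y - z| ^ 2], and the weight [lam] below optimizes the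
   resulting lower bound on [prox M' c y]. *)
Lemma gap_null_step phi M M' c z y g :
  beta < 1 -> 0 <= gap phi M c z ->
  (1 - beta) * rho * gap phi M c z <= 4 * G ^+ 2 ->
  enorm g <= G -> rho * enorm (c - z) <= G ->
  phi c - phi z <= beta * (phi c - M z) ->
  phi z + dot g (y - z) <= M' y ->
  M z + dot (rho *: (c - z)) (y - z) <= M' y ->
  gap phi M' c y <=
    gap phi M c z - (1 - beta) ^+ 2 * rho / (8 * G ^+ 2) * gap phi M c z ^+ 2.
Proof.
move=> beta_lt1 gap0 gap1 gG sG null cutM aggM.
set a := enorm (y - z).
have a0 : 0 <= a := enorm_ge0 _.
have gd : - (G * a) <= dot g (y - z).
  by apply: le_trans (dot_ge_enorm _ _); rewrite lerN2 ler_wpM2r.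
have sd : dot (rho *: (c - z)) (y - z) <= G * a.
  by apply: le_trans (dot_le_enorm _ _) _; rewrite enormZ gtr0_norm// ler_wpM2r.
have proxE : rho / 2 * enorm (y - c) ^+ 2 =
    rho / 2 * enorm (z - c) ^+ 2 + rho / 2 * a ^+ 2
    - dot (rho *: (c - z)) (y - z).
  rewrite !enorm_sqr !dotZl !dotBl !dotBr (dotC c y) (dotC c z) (dotC y z); lra.
have -> : gap phi M' c y = gap phi M c z -
    (M' y - M z - dot (rho *: (c - z)) (y - z) + rho / 2 * a ^+ 2).
  by rewrite /gap /prox proxE; lra.
have gapM : gap phi M c z <= phi c - M z.
  by rewrite /gap /prox lerD2l lerN2 lerDl mulr_ge0 ?sqr_ge0// divr_ge0// ltW.
move: (gap phi M c z) gap0 gap1 gapM => v v0 v1 vM.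
pose lam := (1 - beta) * rho * v / (4 * G ^+ 2).
have G2 : 0 < 4 * G ^+ 2 by rewrite mulr_gt0// exprn_gt0.
have lam0 : 0 <= lam.
  by rewrite divr_ge0 ?(ltW G2)// mulr_ge0// mulr_ge0 ?(ltW rho_gt0)// subr_ge0 ltW.
have lam1 : lam <= 1 by rewrite ler_pdivrMr// mul1r.
have lamE : (1 - beta) * v = 4 * G ^+ 2 * lam / rho.
  by rewrite /lam; field; rewrite !gt_eqF.
have -> : (1 - beta) ^+ 2 * rho / (8 * G ^+ 2) * v ^+ 2 =
    lam * ((1 - beta) * v) / 2.
  by rewrite /lam; field; rewrite gt_eqF.
(* [w] is the excess of the new model over the aggregate cut at [y]. The null-step test bounds it
   below through the new cut, and [w >= lam * w] brings in the weight. The square below vanishes at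
   [a = 2 G lam / rho], the worst distance. *)
set w := M' y - _ - _.
have w0 : 0 <= w by rewrite /w; lra.
have wE : (1 - beta) * v - 2 * G * a <= w.
  have : (1 - beta) * v <= (1 - beta) * (phi c - M z).
    by rewrite ler_wpM2l// subr_ge0 ltW.
  rewrite /w; lra.
have := ler_wpM2l lam0 wE; have := ler_wpM2r w0 lam1.
have : 0 <= (rho * a - 2 * G * lam) ^+ 2 / (2 * rho).
  by rewrite divr_ge0 ?sqr_ge0// mulr_ge0// ltW.
have -> : (rho * a - 2 * G * lam) ^+ 2 / (2 * rho) =
    rho / 2 * a ^+ 2 - 2 * G * lam * a + lam * (4 * G ^+ 2 * lam / rho) / 2.
  by field; rewrite gt_eqF.
rewrite -lamE; lra.
Qed.

Lemma null_steps_bound phi (x g : nat -> 'cV[R]_n) (M : nat -> 'cV[R]_n -> R)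
    (N : nat) (eps : R) :
  beta < 1 -> 0 < eps -> segment_closed -> X (x 0%N) ->
  (forall t, (t <= N)%N -> argmin X (prox (M t) (x 0%N)) (x t.+1)) ->
  (forall t, (t <= N)%N -> elipschitz G (M t)) ->
  (forall t, (t <= N)%N -> enorm (g t) <= G) ->
  M 0%N (x 1%N) = phi (x 0%N) + dot (g 0%N) (x 1%N - x 0%N) ->
  (forall t, (t < N)%N ->
    [/\ phi (x 0%N) - phi (x t.+1) <= beta * (phi (x 0%N) - M t (x t.+1)),
        phi (x t.+1) + dot (g t.+1) (x t.+2 - x t.+1) <= M t.+1 (x t.+2) &
        M t (x t.+1) + dot (rho *: (x 0%N - x t.+1)) (x t.+2 - x t.+1)
          <= M t.+1 (x t.+2)]) ->
  (forall t, (t <= N)%N -> eps <= gap phi (M t) (x 0%N) (x t.+1)) ->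
  N%:R <= 8 * G ^+ 2 / (rho * (1 - beta) ^+ 2 * eps) - 16 / (1 - beta) ^+ 2.
Proof.
move=> beta_lt1 eps_gt0 Xseg X0 x_min ML gG M0 null v_ge.
pose v t := gap phi (M t) (x 0%N) (x t.+1).
pose kappa := (1 - beta) ^+ 2 * rho / (8 * G ^+ 2).
have b0 : 0 < 1 - beta by rewrite subr_gt0.
have G2 : 0 < G ^+ 2 by rewrite exprn_gt0.
have b2 : 0 < (1 - beta) ^+ 2 by rewrite exprn_gt0.
have kappa0 : 0 < kappa by rewrite divr_gt0 ?mulr_gt0.
have v0 : v 0%N <= G ^+ 2 / (2 * rho).
  by apply: gap_affine_le M0; exact: gG.
have v_gt0 t : (t <= N)%N -> 0 < v t by move=> /v_ge; exact: lt_le_trans.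
(* The bound on [v t] keeps the weight [lam] at most 1; as each step decreases [v], the bound
   propagates from [v 0%N] in [v_le]. *)
have step t : (t < N)%N -> v t <= G ^+ 2 / (2 * rho) ->
    v t.+1 <= v t - kappa * v t ^+ 2.
  move=> tN vt; have [? ? ?] := null t tN.
  apply: (@gap_null_step _ _ _ _ _ _ (g t.+1)) => //.
  - exact/ltW/v_gt0/ltnW.
  - have : (1 - beta) * rho * v t <= (1 - beta) * rho * (G ^+ 2 / (2 * rho)).
      by rewrite ler_wpM2l// ltW// mulr_gt0.
    have -> : (1 - beta) * rho * (G ^+ 2 / (2 * rho)) = (1 - beta) * G ^+ 2 / 2.
      by field; rewrite gt_eqF.
    move=> /le_trans; apply.
    have := mulr_gt0 beta_gt0 G2; lra.
  - exact: gG.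
  - exact: (prox_step_bound Xseg (ML t (ltnW tN)) X0 (x_min t (ltnW tN))).
have v_le t : (t <= N)%N -> v t <= G ^+ 2 / (2 * rho).
  elim: t => // t IHt tN; have vt := IHt (ltnW tN).
  apply: le_trans (step t tN vt) (le_trans _ vt).
  by rewrite gerBl mulr_ge0 ?sqr_ge0// ltW.
have -> : 8 * G ^+ 2 / (rho * (1 - beta) ^+ 2 * eps) = (kappa * eps)^-1.
  by rewrite /kappa; field; rewrite ?gt_eqF// !gt_eqF.
(* The offset [c = 16 / (1 - beta) ^ 2] is the number with [kappa * c * (G ^ 2 / (2 * rho)) = 1],
   matching the bound on [v 0%N]. *)
apply: (@reciprocal_growth _ v) => //.
- by rewrite divr_ge0// ltW.
- apply: le_trans (ler_wpM2l _ v0) _.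
    by rewrite mulr_ge0 ?(ltW kappa0)// divr_ge0 ?(ltW b2).
  by rewrite le_eqVlt; apply/orP; left; apply/eqP; rewrite /kappa; field;
    rewrite !gt_eqF.
- by move=> t tN; apply: step => //; apply/v_le/ltnW.
Qed.

(* Test the proximal problem at [c + s (xs - c)] with
   [s = min 1 ((f c - f xs) / (rho D^2))]. *)
Lemma gap_gt (phi f M : 'cV[R]_n -> R) c z xs eps1 eps2 D eta :
  segment_closed ->
  (forall x y s, X x -> X y -> 0 <= s <= 1 ->
    f (x + s *: (y - x)) <= f x + s * (f y - f x)) ->
  (forall x, X x -> f x - eps1 <= phi x <= f x + eps2) ->
  (forall x, X x -> M x <= phi x) ->
  X c -> X xs -> argmin X (prox M c) z -> enorm (xs - c) <= D -> 0 < eta ->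
  Num.max (2 * eta) (Num.sqrt (2 * eta * rho) * D) < f c - f xs ->
  eta - (eps1 + eps2) < gap phi M c z.
Proof.
move=> Xseg fconv fphi Mphi Xc Xxs z_min cD eta0.
have D0 : 0 <= D by apply: le_trans cD; exact: enorm_ge0.
set Delta := f c - f xs; rewrite gt_max => /andP[Delta1 Delta2].
have key s : 0 <= s <= 1 -> eta < s * Delta - rho / 2 * s ^+ 2 * D ^+ 2 ->
    eta - (eps1 + eps2) < gap phi M c z.
  move=> s01 H; have Xx := Xseg c xs s Xc Xxs s01.
  apply: lt_le_trans (gap_ge z_min Xx (Mphi _ Xx)).
  rewrite [c + _]addrC addrK enormZ exprMn real_normK ?num_real//.
  have := fconv c xs s Xc Xxs s01.
  have /andP[+ _] := fphi c Xc; have /andP[_] := fphi _ Xx.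
  rewrite [c + _]addrC.
  have : rho / 2 * s ^+ 2 * enorm (xs - c) ^+ 2 <= rho / 2 * s ^+ 2 * D ^+ 2.
    rewrite ler_wpM2l ?lerXn2r ?nnegrE ?enorm_ge0//.
    by rewrite mulr_ge0 ?sqr_ge0// divr_ge0 ?(ltW rho_gt0).
  move: H; rewrite /Delta; lra.
(* For [s = 1], half of [Delta] absorbs the proximal term and the other half exceeds [eta].
   Otherwise the square-root bound on [Delta] gives [Delta ^ 2 / (2 rho D ^ 2) > eta]. *)
have [rD|rD] := leP (rho * D ^+ 2) Delta.
  by apply: (key 1); [rewrite ler01 lexx|rewrite expr1n; lra].
have rD0 : 0 < rho * D ^+ 2 by apply: lt_trans rD; lra.
have Dsq : 2 * eta * (rho * D ^+ 2) < Delta ^+ 2.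
  have er0 : 0 <= 2 * eta * rho.
    by rewrite mulr_ge0 ?(ltW rho_gt0)// mulr_ge0 ?(ltW eta0).
  have -> : 2 * eta * (rho * D ^+ 2) = (Num.sqrt (2 * eta * rho) * D) ^+ 2.
    by rewrite exprMn sqr_sqrtr//; lra.
  by rewrite ltrXn2r ?nnegrE ?mulr_ge0 ?sqrtr_ge0// ltW//; lra.
apply: (key (Delta / (rho * D ^+ 2))).
  rewrite ler_pdivrMr// mul1r (ltW rD) andbT divr_ge0 ?(ltW rD0)//; lra.
have -> : Delta / (rho * D ^+ 2) * Delta -
    rho / 2 * (Delta / (rho * D ^+ 2)) ^+ 2 * D ^+ 2 =
    Delta ^+ 2 / (rho * D ^+ 2) / 2.
  have D_neq0 : D != 0 by apply: contraTneq rD0 => ->; rewrite expr0n mulr0 ltxx.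
  by field; rewrite D_neq0 gt_eqF.
have : 2 * eta < Delta ^+ 2 / (rho * D ^+ 2) by rewrite ltr_pdivlMr.
lra.
Qed.

End BundleMethod.

(** * Cuts, the feasible set, and the complexity bound *)

Lemma affine_elipschitz (R : realType) n (G a : R) (g c : 'cV[R]_n) :
  enorm g <= G -> elipschitz G (fun x => a + dot g (x - c)).
Proof.
move=> gG x y; rewrite opprD addrACA subrr add0r -dotBr opprB addrA subrK.
apply: le_trans (ler_wpM2r (enorm_ge0 _) gG).
by rewrite ler_norml dot_ge_enorm dot_le_enorm.
Qed.

Lemma feasible_segment_closed (R : realType) m n r l Xi
    (p : slp R m n r l Xi) : segment_closed (feasible p).
Proof.
move=> x y s [Ax x0] [Ay y0] /andP[s0 s1]; split.
  by rewrite mulmxDr -scalemxAr mulmxBr Ax Ay subrr scaler0 addr0.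
move=> i; rewrite !mxE; have := x0 i; have := y0 i; rewrite !mxE => yi xi.
have -> : x i 0 + s * (y i 0 - x i 0) = (1 - s) * x i 0 + s * y i 0 by ring.
by rewrite addr_ge0// mulr_ge0// subr_ge0.
Qed.

Theorem theorem1 (R : realType) (m n r l : nat)
  (d : measure_display) (Omega : measurableType d) (P : probability Omega R)
  (d' : measure_display) (Xi : measurableType d') (xi : {RV P >-> Xi})
  (p : slp R m n r l Xi)
  (f : 'cV[R]_n -> \bar R) (f_def : f = objective p P xi)
  (f_real : forall x, feasible p x ->
     P.-integrable [set: Omega] (fun w => recourse p x (xi w)))
  (f_convex : convex_function (feasible p) (fun x => fine (f x)))
  (fstar : R)
  (fstar_min : is_minimum (feasible p) (fun x => fine (f x)) fstar)
  (beta : R) (beta_gt0 : 0 < beta) (beta_lt1 : beta < 1)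
  (rhok : nat -> R) (rhok_gt0 : forall k, 0 < rhok k)
  (U : 'cV[R]_n -> Xi -> 'cV[R]_r)
  (e : execution R n Xi)
  (U_dual : forall k, reached e k -> forall x, feasible p x ->
     forall s, s \in samples e k -> dual_solutions p x s (U x s))
  (e_exec : is_execution p U beta rhok e)
  (D : R)
  (X_nonempty : feasible p !=set0)
  (X_diam : forall x y, feasible p x -> feasible p y -> enorm (x - y) <= D)
  (eps1 eps2 : R)
  (fhat_approx : forall k, reached e k -> forall x, feasible p x ->
     (f x - eps1%:E <= fhatk p e k x <= f x + eps2%:E)%E)
  (G : R) (G_gt0 : 0 < G)
  (ghat_bounded : forall k, reached e k -> forall x, feasible p x ->
     enorm (ghatk p U e k x) <= G)
  (bundle_cond : forall k t, reached e k -> before t.+1 (inner e k) ->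
     [/\ convex_function [set: 'cV[R]_n] (model e k t.+1),
         elipschitz G (model e k t.+1) &
         forall x, ((model e k t.+1 x)%:E <= fhatk p e k x)%E /\
           Num.max (cut p U e k t.+1 x) (aggcut rhok e k t x)
             <= model e k t.+1 x])
  (epsbar : R) (epsbar_def : epsbar = (beta + 1) * (eps1 + eps2))
  (epsbar_gt0 : 0 < epsbar) (epsbar_lt1 : epsbar < 1)
  (rho : R) (rho_gt0 : 0 < rho) (rhok_const : forall k, rhok k = rho)
  (deltaC : R)
  (deltaC_def : deltaC = Num.max (4 * epsbar / beta)
                                 (Num.sqrt (4 * epsbar * rho / beta) * D))
  (KC : int)
  (KC_def : KC = Num.max 0
     (Num.ceil ((fine (f (iterate e 0 0)) - fstar - deltaC) / epsbar))) :
  (exists k, [/\ reached e k, k%:Z <= KC &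
                 fine (f (iterate e k 0)) - fstar <= deltaC]) /\
  (forall k, reached e k ->
     fine (f (iterate e k 0)) - fstar <= deltaC ->
     (forall j, (j < k)%N -> deltaC < fine (f (iterate e j 0)) - fstar) ->
     (inner_steps e k)%:Z <=
       (Num.ceil (8 * G ^+ 2 / (rho * (1 - beta) ^+ 2 * epsbar)
                  - 16 / (1 - beta) ^+ 2) + 1) * KC).
Proof.
have feas_seg := @feasible_segment_closed _ _ _ _ _ _ p.
pose F x := fine (f x); pose phi k x := fine (fhatk p e k x).
have F_conv x y s : feasible p x -> feasible p y -> 0 <= s <= 1 ->
    F (x + s *: (y - x)) <= F x + s * (F y - F x).
  by move=> Xx Xy s01; exact: (convex_function_segment f_convex).
have [init_feas exec] := e_exec.
(* [T_k] is never 0, so the next centre [x_{k,T_k}] is a proximal minimizer and lies in the feasible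
   set. *)
have iter_feas k : reached e k -> feasible p (iterate e k 0%N).
  elim: k => // k IHk rk; have rk' : reached e k by move=> j /leqW/rk.
  have [_ _ x_min [N0 _] [_ x_next]] := exec k rk'.
  have := rk k (ltnSn k); case E : (inner e k) N0 => [N|//] N0 _.
  rewrite (x_next N E); case: N E N0 {x_next} => [_ //|N E _].
  by have [] := x_min N _; rewrite ?E //=.
have f_fin x : feasible p x -> f x \is a fin_num.
  move=> Xx; rewrite f_def fin_numD/= integrable_fin_num//.
  exact: f_real.
have phiE k x : reached e k -> feasible p x -> fhatk p e k x = (phi k x)%:E.
  by move=> rk Xx; rewrite /phi /fhatk (fhatE (U_dual k rk x Xx)).
have F_phi k x : reached e k -> feasible p x ->
    F x - eps1 <= phi k x <= F x + eps2.
  move=> rk Xx; have := fhat_approx k rk x Xx.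
  by rewrite (phiE k x rk Xx) -(fineK (f_fin x Xx)) -EFinB -EFinD !lee_fin.
have M_le k t x : reached e k -> before t (inner e k) -> feasible p x ->
    model e k t x <= phi k x.
  move=> rk tT Xx; case: t tT => [|t] tT.
    have [_ -> _ _ _] := exec k rk.
    exact: (ghat_subgradient (U_dual k rk _ (iter_feas k rk)) (U_dual k rk x Xx)).
  have [_ _ /(_ x)[+ _]] := bundle_cond k t rk tT.
  by rewrite (phiE k x rk Xx) lee_fin.
have M_lip k t : reached e k -> before t (inner e k) ->
    elipschitz G (model e k t).
  move=> rk; case: t => [|t] tT; last by have [] := bundle_cond k t rk tT.
  have [_ M0 _ _ _] := exec k rk => x y; rewrite !M0.
  exact/affine_elipschitz/(ghat_bounded k rk _ (iter_feas k rk)).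
have x_min k t : reached e k -> before t (inner e k) ->
    argmin (feasible p) (prox rho (model e k t) (iterate e k 0%N))
      (iterate e k t.+1).
  by move=> rk tT; have [_ _ /(_ t tT) + _ _] := exec k rk; rewrite rhok_const.
have [xs [Xxs _] Fxs] := fstar_min.
pose Delta k := F (iterate e k 0%N) - fstar.
pose v k t := gap rho (phi k) (model e k t) (iterate e k 0%N) (iterate e k t.+1).
have gap_lb k t : reached e k -> before t (inner e k) -> deltaC < Delta k ->
    2 * epsbar / beta - (eps1 + eps2) < v k t.
  move=> rk tT; rewrite /Delta -Fxs => kD; have Xk := iter_feas k rk.
  (* Taking [eta = 2 epsbar / beta] turns the threshold of [gap_gt] into [deltaC]. *)
  apply: (gap_gt rho_gt0 feas_seg F_conv _ _ Xk Xxs (x_min k t rk tT)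
    (X_diam _ _ Xxs Xk)).
  - by move=> x; exact: F_phi.
  - by move=> x; exact: M_le.
  - by rewrite divr_gt0// mulr_gt0.
  - rewrite (_ : 2 * (2 * epsbar / beta) = 4 * epsbar / beta); last by ring.
    by rewrite (mulrAC (4 * epsbar)) -deltaC_def.
have eps_pos : 0 < eps1 + eps2.
  by move: epsbar_gt0; rewrite epsbar_def pmulr_rgt0// addr_gt0.
have gap_eps k t : reached e k -> before t (inner e k) -> deltaC < Delta k ->
    epsbar <= v k t.
  move=> rk tT kD; apply: le_trans (ltW (gap_lb k t rk tT kD)).
  have : 2 * epsbar <= 2 * epsbar / beta.
    by rewrite ler_pdivlMr// ger_pMr ?mulr_gt0// ltW.
  have := mulr_gt0 beta_gt0 eps_pos; rewrite epsbar_def; lra.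
set B := 8 * G ^+ 2 / _ - _.
(* If inner iteration [N] takes place, all steps before it are null: a serious step at [t] would
   force [T_k = t + 1], yet [t + 1 <= N < T_k]. *)
have inner_bound k N : reached e k -> deltaC < Delta k ->
    before N (inner e k) -> N%:R <= B.
  move=> rk kD NT; have [_ M0 _ [_ ser] _] := exec k rk.
  have le_before t : (t <= N)%N -> before t (inner e k).
    by case: (inner e k) NT => //= T NT /leq_ltn_trans; apply.
  have x_feas t : (t <= N)%N -> feasible p (iterate e k t).
    case: t => [_|t tN]; first exact: iter_feas.
    by have [] := x_min k t rk (le_before t (ltnW tN)).
  apply: (null_steps_bound (phi := phi k) (x := iterate e k) (M := model e k)
    (g := fun t => ghatk p U e k (iterate e k t)) rho_gt0 G_gt0 beta_gt0
    beta_lt1 epsbar_gt0 feas_seg).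
  - exact: iter_feas.
  - by move=> t /le_before; exact: x_min.
  - by move=> t /le_before; exact: M_lip.
  - by move=> t /x_feas; exact: (ghat_bounded k rk).
  - exact: M0.
  - move=> t tN.
    have [_ _ /(_ (iterate e k t.+2))[_]] := bundle_cond k t rk (le_before _ tN).
    rewrite ge_max /cut /aggcut /sgrad rhok_const => /andP[cutM aggM].
    split=> //; rewrite leNgt; apply/negP => nser.
    have /ser : before t (inner e k) by exact/le_before/ltnW.
    move=> -[/(_ (ltW nser)) Tt _].
    by have := le_before t.+1 tN; rewrite Tt /= ltnn.
  - by move=> t /le_before tT; exact: gap_eps.
have inner_fin k : reached e k -> deltaC < Delta k ->
    exists2 N, inner e k = Some N.+1 & N%:Z <= Num.ceil B.
  move=> rk kD; case E : (inner e k) => [T|].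
    have [_ _ _ [T0 _] _] := exec k rk.
    case: T E => [E|N E]; first by rewrite E in T0.
    exists N => //; rewrite -(ler_int R) (le_trans _ (ceil_ge B))//.
    by apply: (inner_bound k N rk kD); rewrite E /=.
  have := inner_bound k `|Num.ceil B|.+1 rk kD; rewrite E => /(_ isT).
  rewrite leNgt => /negP[]; apply: le_lt_trans (ceil_ge B) _.
  rewrite -[ltRHS]/((`|Num.ceil B|.+1)%:~R) ltr_int.
  by move: (Num.ceil B) => z; clear; lia.
have reachedS k : reached e k -> deltaC < Delta k -> reached e k.+1.
  move=> rk kD j; rewrite ltnS leq_eqVlt => /predU1P[->|]; last exact: rk.
  by have [N ->] := inner_fin k rk kD.
have Delta_dec k : reached e k -> deltaC < Delta k ->
    Delta k.+1 <= Delta k - epsbar.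
  move=> rk kD; have [N E _] := inner_fin k rk kD.
  have NT : before N (inner e k) by rewrite E /=.
  have [_ _ _ [_ /(_ N NT)[_ /(_ E) ser]] [_ /(_ _ E) x_next]] := exec k rk.
  set x0 := iterate e k 0%N in ser; set x1 := iterate e k N.+1 in ser.
  have {}ser : beta * (phi k x0 - model e k N x1) <= phi k x0 - phi k x1 := ser.
  have vM : v k N <= phi k x0 - model e k N x1.
    by rewrite lerD2l lerN2 lerDl mulr_ge0 ?sqr_ge0// divr_ge0// ltW.
  have [Xx1 _] := x_min k N rk NT.
  have /andP[_ F0] := F_phi k x0 rk (iter_feas k rk).
  have /andP[F1 _] := F_phi k x1 rk Xx1.
  (* The serious-step test gives a decrease of [phi k] by at least [2 epsbar - beta (eps1 + eps2)];
     passing to [F] loses another [eps1 + eps2], which leaves exactly [epsbar]. *)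
  have := ler_wpM2l (ltW beta_gt0) (le_trans (ltW (gap_lb k N rk NT kD)) vM).
  rewrite mulrBr [beta * (_ / _)]mulrC divfK ?gt_eqF//.
  rewrite /Delta x_next -/x0 -/x1; move: F0 F1 ser epsbar_def; lra.
(* Non-optimality is assumed only at reached iterations, and it makes their inner loops terminate,
   so the two facts advance together. *)
have reached_lt k :
    (forall j, (j < k)%N -> reached e j -> deltaC < Delta j) -> reached e k.
  elim: k => // k IHk H; have rk : reached e k by apply: IHk => j /leqW; exact: H.
  by apply: reachedS => //; apply: H.
have Delta_sum k : (forall j, (j < k)%N -> reached e j -> deltaC < Delta j) ->
    Delta k <= Delta 0%N - k%:R * epsbar.
  move=> H; apply: descent_sum => j jk; have rj : reached e j.
    by apply: reached_lt => i ij; apply: H; exact: ltn_trans jk.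
  by apply: Delta_dec => //; exact: H.
have KC_ge0 : 0 <= KC by rewrite KC_def le_max lexx.
have KC_ub : (Delta 0%N - deltaC) / epsbar <= KC%:~R.
  rewrite KC_def; apply: le_trans (ceil_ge _) _.
  by rewrite ler_int le_max lexx orbT.
split.
  apply: contrapT => noK.
  have far j : (j < `|KC|.+1)%N -> reached e j -> deltaC < Delta j.
    move=> jK rj; rewrite ltNge; apply/negP => jD; apply: noK; exists j; split=> //.
    lia.
  have rK : reached e `|KC| by apply: reached_lt => j /leqW; exact: far.
  have := far `|KC|%N (ltnSn _) rK; apply/negP; rewrite -leNgt.
  apply: le_trans (Delta_sum _ _) _ => [j /leqW|]; first exact: far.
  move: KC_ub; rewrite ler_pdivrMr// -[KC in KC%:~R]gez0_abs//; lra.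
move=> k rk kD far.
have k_le : k%:Z <= KC.
  (* When the first accurate iteration is [k.+1], iteration [k] is still inaccurate; the summed
     decrease gives [k < KC] strictly, hence [k.+1 <= KC]. *)
  case: k rk kD far => // k _ _ far.
  have far_k := far k (ltnSn k).
  have sum_k := Delta_sum k (fun j jk _ => far j (leqW jk)).
  have : k%:~R < KC%:~R :> R.
    apply: lt_le_trans KC_ub; rewrite ltr_pdivlMr// -[k%:~R]/(k%:R).
    by move: far_k; rewrite -/(Delta k); lra.
  by rewrite ltr_int; clear; lia.
have step_bound j : (j < k)%N ->
    exists2 N, inner e j = Some N.+1 & N%:Z <= Num.ceil B.
  move=> jk; apply: inner_fin; last exact: far.
  by move=> i ij; apply: rk; exact: ltn_trans jk.
(* For [k = 0] the sign of [Num.ceil B] is unknown, but then [KC = 0] and both sides vanish. *)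
case: k rk kD far k_le step_bound => [|k] rk kD far k_le step_bound.
  have -> : KC = 0.
    rewrite KC_def; apply/max_idPl.
    by rewrite ceil_le0 pmulr_lle0 ?invr_gt0// subr_le0.
  by rewrite mulr0 /inner_steps big_ord0.
(* A completed inaccurate outer iteration forces [Num.ceil B >= 0], so the absolute value below
   changes nothing and [k.+1 <= KC] may be multiplied by [Num.ceil B + 1]. *)
have [N0 _ N0_le] := step_bound 0%N isT.
have : (inner_steps e k.+1 <= \sum_(j < k.+1) `|(Num.ceil B + 1)%R|)%N.
  apply: leq_sum => j _; have [N -> /=] := step_bound j (ltn_ord j).
  by move: (Num.ceil B) => z; clear; lia.
rewrite sum_nat_const card_ord; move: (inner_steps e _) (Num.ceil B) N0_le k_le.
by clear; move=> *; nia.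
Qed.
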